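(* Let $R$ be a ring and let $(P,Q,\psi)$ be an $R$-system which satisfies condition (FS). If $(\Delta^{-1}(\mathcal{F}_P(Q))\cap(\ker\Delta)^\perp)\cap\ker\Delta=\{0\}$, then $J:=\Delta^{-1}(\mathcal{F}_P(Q))\cap(\ker\Delta)^\perp$ is a uniquely maximal faithful $\psi$-compatible two-sided ideal of $R$. (Thus the Cuntz-Pimsner ring of $(P,Q,\psi)$ is defined in this case.)
   Context: Rings are associative, not necessarily unital. For $R$-bimodules $P,Q$, $P\otimes Q$ is the $R$-balanced tensor product. An $R$-system is a triple $(P,Q,\psi)$ where $P,Q$ are $R$-bimodules and $\psi:P\otimes Q\to R$ is an $R$-bimodule homomorphism. For $p\in P,q\in Q$: $\theta_{q,p}:Q\to Q$, $x\mapsto q\psi(p\otimes x)$, and $\theta_{p,q}:P\to P$, $y\mapsto\psi(y\otimes q)p$. $\mathcal{F}_P(Q)$ is the additive span of all $\theta_{q,p}$, $\mathcal{F}_Q(P)$ the additive span of all $\theta_{p,q}$. Condition (FS): for all finite sets $\{q_1,\dots,q_n\}\subseteq Q$, $\{p_1,\dots,p_m\}\subseteq P$ there exist $\Theta\in\mathcal{F}_P(Q)$ and $\Omega\in\mathcal{F}_Q(P)$ with $\Theta(q_i)=q_i$ and $\Omega(p_j)=p_j$ for all $i,j$. $\Delta:R\to\operatorname{End}(Q_R)$ is the ring homomorphism $\Delta(r)(q)=rq$. A two-sided ideal $J$ of $R$ is $\psi$-compatible if $J\subseteq\Delta^{-1}(\mathcal{F}_P(Q))$; a $\psi$-compatible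 $J$ is faithful if $J\cap\ker\Delta=\{0\}$; a faithful $\psi$-compatible two-sided ideal $J$ is uniquely maximal if $J'\subseteq J$ for every faithful $\psi$-compatible two-sided ideal $J'$ of $R$. For a two-sided ideal $J$ of $R$, $J^\perp:=\{x\in R:\ xy=yx=0\text{ for all }y\in J\}$. The Cuntz-Pimsner ring of $(P,Q,\psi)$ is by definition defined exactly when a uniquely maximal faithful $\psi$-compatible two-sided ideal $J$ exists. *)

(* Defs.v *)
From HB Require Import structures.
From mathcomp Require Import all_boot all_order all_algebra.
From mathcomp Require Import generic_quotient ring_quotient.
From mathcomp Require Import boolp classical_sets functions.
From mathcomp.multinomials Require Import freeg.

Set Implicit Arguments.
Unset Strict Implicit.
Unset Printing Implicit Defensive.

Import GRing.Theory.

Local Open Scope ring_scope.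
Local Open Scope quotient_scope.
Local Open Scope classical_set_scope.

Reserved Notation "x ** y" (at level 40, left associativity).
Reserved Notation "r **: x" (at level 40, left associativity).
Reserved Notation "x :** r" (at level 40, left associativity).
Reserved Notation "P \ox Q" (at level 40, left associativity).
Reserved Notation "p \oxe q" (at level 40, left associativity).
Reserved Notation "{ 'bimod' M -> N }" (M at level 98, N at level 99).

(* Associative rings with no unit assumed; GRing.PzRing always has one. *)
HB.mixin Record Zmodule_isRng R of GRing.Zmodule R := {
  rngmul : R -> R -> R;
  rngmulA : associative rngmul;
  rngmulDl : left_distributive rngmul +%R;
  rngmulDr : right_distributive rngmul +%R
}.

#[short(type="rngType")]
HB.structure Definition Rng := {R of GRing.Zmodule R & Zmodule_isRng R}.

Notation "x ** y" := (rngmul x y) : ring_scope.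

HB.mixin Record Zmodule_isBimodule (R : rngType) M of GRing.Zmodule M := {
  lact : R -> M -> M;
  ract : M -> R -> M;
  lactDr : forall r x y, lact r (x + y) = lact r x + lact r y;
  lactDl : forall r s x, lact (r + s) x = lact r x + lact s x;
  lactA : forall r s x, lact (r ** s) x = lact r (lact s x);
  ractDl : forall x y r, ract (x + y) r = ract x r + ract y r;
  ractDr : forall x r s, ract x (r + s) = ract x r + ract x s;
  ractA : forall x r s, ract x (r ** s) = ract (ract x r) s;
  lractA : forall r x s, ract (lact r x) s = lact r (ract x s)
}.

#[short(type="bimodType")]
HB.structure Definition Bimodule (R : rngType) :=
  {M of GRing.Zmodule M & Zmodule_isBimodule R M}.

Notation "r **: x" := (lact r x) : ring_scope.
Notation "x :** r" := (ract x r) : ring_scope.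

(* R as a bimodule over itself, as an alias of R in the manner of R^o. *)
Definition regular (R : rngType) : Type := R.
HB.instance Definition _ (R : rngType) := GRing.Zmodule.on (regular R).
HB.instance Definition _ (R : rngType) :=
  Zmodule_isBimodule.Build R (regular R)
    (fun r x y => rngmulDr r x y) (fun r s x => rngmulDl r s x)
    (fun r s x => esym (rngmulA r s x))
    (fun x y r => rngmulDl x y r) (fun x r s => rngmulDr x r s)
    (fun x r s => rngmulA x r s) (fun r x s => esym (rngmulA r x s)).

HB.mixin Record isBimodHom (R : rngType) (M N : bimodType R) (f : M -> N) := {
  bimod_homL : forall r x, f (r **: x) = r **: f x;
  bimod_homR : forall x r, f (x :** r) = f x :** r
}.

HB.structure Definition BimodHom (R : rngType) (M N : bimodType R) :=
  {f of isBimodHom R M N f & @GRing.Additive M N f}.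

Notation "{ 'bimod' M -> N }" := (BimodHom.type M N) : type_scope.

Section AdditiveMaps.
Variables (U V W : zmodType).

Lemma additive_map0 (f : U -> V) : zmod_morphism f -> f 0 = 0.
Proof. by move=> fB; have := fB 0 0; rewrite !subrr. Qed.

Lemma additive_mapD (f : U -> V) : zmod_morphism f -> {morph f : x y / x + y}.
Proof.
move=> fB x y; have fN z : f (- z) = - f z.
  by rewrite -[- z]sub0r fB additive_map0 // sub0r.
by rewrite -[y in LHS]opprK fB fN opprK.
Qed.

Lemma additive_add (f g : U -> V) :
  zmod_morphism f -> zmod_morphism g -> zmod_morphism (fun x => f x + g x).
Proof. by move=> fB gB x y; rewrite fB gB opprD addrACA. Qed.

Lemma additive_comp (f : V -> W) (g : U -> V) :
  zmod_morphism f -> zmod_morphism g -> zmod_morphism (f \o g).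
Proof. by move=> fB gB x y; rewrite /= gB fB. Qed.

End AdditiveMaps.

Section AdditiveSubgroups.
Variable V : zmodType.

Definition add_subgroup (A : set V) : Prop :=
  A 0 /\ forall x y, A x -> A y -> A (x - y).

Definition add_span (G : set V) : set V := smallest add_subgroup G.

Lemma add_span_subgroup G : add_subgroup (add_span G).
Proof.
split; first by move=> A [[A0 _] _].
by move=> x y xG yG A AG; case: (AG) => -[_ AB] _; apply: AB; [exact: xG|exact: yG].
Qed.

End AdditiveSubgroups.

(* The R-balanced tensor product: the free abelian group on the pairs (p, q),
   modulo the subgroup generated by the usual relations. *)
Section Tensor.
Variables (R : rngType) (P Q : bimodType R).

Local Notation free_pairs := {freeg (P * Q)%type / int}.

Definition free_pair (p : P) (q : Q) : free_pairs := << (p, q) >>.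

Inductive tensor_relation : set free_pairs :=
| TensorDl p p' q :
    tensor_relation (free_pair (p + p') q - free_pair p q - free_pair p' q)
| TensorDr p q q' :
    tensor_relation (free_pair p (q + q') - free_pair p q - free_pair p q')
| TensorBalanced p r q :
    tensor_relation (free_pair (p :** r) q - free_pair p (r **: q)).

Definition tensor_kernel : {pred free_pairs} :=
  fun x => `[< add_span tensor_relation x >].

Fact tensor_kernel_zmod_closed : zmod_closed tensor_kernel.
Proof.
have [s0 sB] := add_span_subgroup tensor_relation.
split; first by rewrite unfold_in; apply/asboolP.
move=> x y; rewrite !unfold_in => /asboolP xK /asboolP yK.
apply/asboolP; exact: sB.
Qed.

HB.instance Definition _ :=
  GRing.isZmodClosed.Build free_pairs tensor_kernel tensor_kernel_zmod_closed.

Definition tensor : Type := {ideal_quot tensor_kernel}.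
HB.instance Definition _ := GRing.Zmodule.on tensor.

Definition tensor_pi (x : free_pairs) : tensor :=
  \pi_{ideal_quot tensor_kernel} x.

Definition tensor_repr (t : tensor) : free_pairs :=
  repr (t : {ideal_quot tensor_kernel}).

Definition pure_tensor (p : P) (q : Q) : tensor := tensor_pi (free_pair p q).

End Tensor.

Notation "P \ox Q" := (tensor P Q) : type_scope.
Notation "p \oxe q" := (pure_tensor p q) : ring_scope.

Section TensorTheory.
Variables (R : rngType) (P Q : bimodType R).
Implicit Types (p : P) (q : Q) (r : R).

Local Notation fpair := (@free_pair R P Q).
Local Notation kernel := (@tensor_kernel R P Q).

Lemma tensor_reprK : cancel (@tensor_repr R P Q) (@tensor_pi R P Q).
Proof. exact: reprK. Qed.

Lemma tensor_piE (x y : {freeg (P * Q)%type / int}) :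
  tensor_pi x = tensor_pi y <-> add_span (@tensor_relation R P Q) (x - y).
Proof.
rewrite -(asboolE (add_span _ _)) -[`[< _ >]]/(x - y \in kernel).
by rewrite Quotient.idealrBE; split=> /eqP.
Qed.

Lemma tensor_pi_additive : zmod_morphism (@tensor_pi R P Q).
Proof. exact: pi_is_zmod_morphism. Qed.

Lemma tensor_piK x : tensor_relation x -> tensor_pi x = 0 :> P \ox Q.
Proof.
move=> xK; rewrite -(additive_map0 tensor_pi_additive); apply/tensor_piE.
by rewrite subr0; apply: sub_gen_smallest.
Qed.

Lemma pure_tensorDl p p' q : (p + p') \oxe q = p \oxe q + p' \oxe q.
Proof.
apply/eqP; rewrite -subr_eq0 opprD addrA; apply/eqP.
rewrite -(tensor_piK (TensorDl p p' q)) -[LHS]/(_ - _ - _).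
by rewrite 2!tensor_pi_additive.
Qed.

Lemma pure_tensorDr p q q' : p \oxe (q + q') = p \oxe q + p \oxe q'.
Proof.
apply/eqP; rewrite -subr_eq0 opprD addrA; apply/eqP.
rewrite -(tensor_piK (TensorDr p q q')) -[LHS]/(_ - _ - _).
by rewrite 2!tensor_pi_additive.
Qed.

Lemma pure_tensor_balanced p r q : (p :** r) \oxe q = p \oxe (r **: q).
Proof.
apply/eqP; rewrite -subr_eq0; apply/eqP.
by rewrite -(tensor_piK (TensorBalanced p r q)) tensor_pi_additive.
Qed.

Lemma free_pairs_ind (V : zmodType)
    (f g : {additive {freeg (P * Q)%type / int} -> V}) :
  (forall p q, f (fpair p q) = g (fpair p q)) -> f =1 g.
Proof.
move=> fg x; rewrite -[x]freeg_sumE !raddf_sum; apply: eq_bigr => -[p q] _.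
have -> : << coeff (p, q) x *g (p, q) >> = fpair p q *~ coeff (p, q) x.
  by rewrite /free_pair freegU_mulz intz.
by rewrite !raddfMz fg.
Qed.

Lemma tensor_ext (V : zmodType) (f g : P \ox Q -> V) :
  zmod_morphism f -> zmod_morphism g ->
  (forall p q, f (p \oxe q) = g (p \oxe q)) -> f =1 g.
Proof.
move=> fB gB fg t.
pose f' (x : {freeg (P * Q)%type / int}) := f (tensor_pi x).
pose g' (x : {freeg (P * Q)%type / int}) := g (tensor_pi x).
have f'B : zmod_morphism f' by move=> x y; rewrite /f' tensor_pi_additive fB.
have g'B : zmod_morphism g' by move=> x y; rewrite /g' tensor_pi_additive gB.
pose F := GRing.isZmodMorphism.Build _ _ f' f'B.
pose G := GRing.isZmodMorphism.Build _ _ g' g'B.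
pose fa : {additive _ -> _} := HB.pack f' F.
pose ga : {additive _ -> _} := HB.pack g' G.
have := @free_pairs_ind V fa ga fg (tensor_repr t).
by rewrite /= /f' /g' tensor_reprK.
Qed.

Section Lift.
Variables (V : zmodType) (f : P -> Q -> V).
Hypothesis fDl : forall p p' q, f (p + p') q = f p q + f p' q.
Hypothesis fDr : forall p q q', f p (q + q') = f p q + f p q'.
Hypothesis f_bal : forall p r q, f (p :** r) q = f p (r **: q).

Let flift : {freeg (P * Q)%type / int} -> V :=
  fglift (fun pq => f pq.1 pq.2 : zmodule V).

Let fliftB : zmod_morphism flift.
Proof. exact: (@lift_is_additive int (P * Q)%type (zmodule V) _). Qed.

Let flift_pair p q : flift (fpair p q) = f p q.
Proof. by rewrite /flift liftU scale1r. Qed.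

Definition tensor_lift (t : P \ox Q) : V :=
  flift (tensor_repr t).

Let flift_kernel x : add_span (@tensor_relation R P Q) x -> flift x = 0.
Proof.
move: x; apply: (@smallest_sub _ _ _ [set x | flift x = 0]).
  split=> [|x y /= x0 y0].
    exact: additive_map0 fliftB.
  by rewrite fliftB x0 y0 subrr.
move=> _ [p p' q|p q q'|p r q] /=; rewrite !fliftB !flift_pair.
- by rewrite fDl -addrA -opprD subrr.
- by rewrite fDr -addrA -opprD subrr.
- by rewrite f_bal subrr.
Qed.

Let tensor_lift_pi x : tensor_lift (tensor_pi x) = flift x.
Proof.
apply/eqP; rewrite -subr_eq0 -fliftB; apply/eqP/flift_kernel/tensor_piE.
exact: tensor_reprK.
Qed.

Lemma tensor_liftE p q : tensor_lift (p \oxe q) = f p q.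
Proof. by rewrite tensor_lift_pi flift_pair. Qed.

Lemma tensor_lift_additive : zmod_morphism tensor_lift.
Proof.
move=> s t; rewrite -[s in LHS]tensor_reprK -[t in LHS]tensor_reprK.
by rewrite -tensor_pi_additive tensor_lift_pi fliftB.
Qed.

End Lift.

Definition tensor_lact r : P \ox Q -> P \ox Q :=
  tensor_lift (fun p q => (r **: p) \oxe q).

Definition tensor_ract (t : P \ox Q) r : P \ox Q :=
  tensor_lift (fun p q => p \oxe (q :** r)) t.

Let lactP r : zmod_morphism (tensor_lact r) *
  (forall p q, tensor_lact r (p \oxe q) = (r **: p) \oxe q).
Proof.
split; [apply: tensor_lift_additive|move=> p q; apply: (tensor_liftE (f := fun p q => _))].
all: move=> *; rewrite ?lactDr ?pure_tensorDl ?pure_tensorDr //.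
all: by rewrite -lractA pure_tensor_balanced.
Qed.

Let ractP r : zmod_morphism (tensor_ract^~ r) *
  (forall p q, tensor_ract (p \oxe q) r = p \oxe (q :** r)).
Proof.
split; [apply: tensor_lift_additive|move=> p q; apply: (tensor_liftE (f := fun p q => _))].
all: move=> *; rewrite ?ractDl ?pure_tensorDl ?pure_tensorDr //.
all: by rewrite lractA pure_tensor_balanced.
Qed.

Fact tensor_lactDr r x y :
  tensor_lact r (x + y) = tensor_lact r x + tensor_lact r y.
Proof. exact: (additive_mapD (lactP r).1). Qed.

Fact tensor_lactDl r s x :
  tensor_lact (r + s) x = tensor_lact r x + tensor_lact s x.
Proof.
move: x; apply: tensor_ext => [||p q].
- exact: (lactP _).1.
- exact: (additive_add (lactP _).1 (lactP _).1).
- by rewrite !(lactP _).2 lactDl pure_tensorDl.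
Qed.

Fact tensor_lactA r s x :
  tensor_lact (r ** s) x = tensor_lact r (tensor_lact s x).
Proof.
move: x; apply: tensor_ext => [||p q].
- exact: (lactP _).1.
- exact: (additive_comp (lactP _).1 (lactP _).1).
- by rewrite !(lactP _).2 lactA.
Qed.

Fact tensor_ractDl x y r :
  tensor_ract (x + y) r = tensor_ract x r + tensor_ract y r.
Proof. exact: (additive_mapD (ractP r).1). Qed.

Fact tensor_ractDr x r s :
  tensor_ract x (r + s) = tensor_ract x r + tensor_ract x s.
Proof.
move: x; apply: tensor_ext => [||p q].
- exact: (ractP _).1.
- exact: (additive_add (ractP _).1 (ractP _).1).
- by rewrite !(ractP _).2 ractDr pure_tensorDr.
Qed.

Fact tensor_ractA x r s :
  tensor_ract x (r ** s) = tensor_ract (tensor_ract x r) s.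
Proof.
move: x; apply: tensor_ext => [||p q].
- exact: (ractP _).1.
- exact: (additive_comp (ractP _).1 (ractP _).1).
- by rewrite !(ractP _).2 ractA.
Qed.

Fact tensor_lractA r x s :
  tensor_ract (tensor_lact r x) s = tensor_lact r (tensor_ract x s).
Proof.
move: x; apply: tensor_ext => [||p q].
- exact: (additive_comp (ractP _).1 (lactP _).1).
- exact: (additive_comp (lactP _).1 (ractP _).1).
- by rewrite (lactP _).2 !(ractP _).2 (lactP _).2.
Qed.

HB.instance Definition _ := Zmodule_isBimodule.Build R (P \ox Q)
  tensor_lactDr tensor_lactDl tensor_lactA tensor_ractDl tensor_ractDr
  tensor_ractA tensor_lractA.

Lemma lact_pure_tensor r p q : r **: (p \oxe q) = (r **: p) \oxe q.
Proof. exact: (lactP r).2. Qed.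

Lemma ract_pure_tensor p q r : (p \oxe q) :** r = p \oxe (q :** r).
Proof. exact: (ractP r).2. Qed.

End TensorTheory.

(* rend M is End(M_R), lend M is End of M as a left R-module. *)
Section ModuleEndomorphisms.
Variables (R : rngType) (M : bimodType R).
Implicit Types f : M -> M.

Definition right_linear : {pred M -> M} := fun f =>
  `[< zmod_morphism f /\ forall x r, f (x :** r) = f x :** r >].

Definition left_linear : {pred M -> M} := fun f =>
  `[< zmod_morphism f /\ forall r x, f (r **: x) = r **: f x >].

Record rend := REnd { rend_fun :> M -> M; _ : rend_fun \in right_linear }.
Record lend := LEnd { lend_fun :> M -> M; _ : lend_fun \in left_linear }.

HB.instance Definition _ := [isSub for rend_fun].
HB.instance Definition _ := [Choice of rend by <:].
HB.instance Definition _ := [isSub for lend_fun].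
HB.instance Definition _ := [Choice of lend by <:].

Let ractB (x y : M) r : (x - y) :** r = x :** r - y :** r.
Proof. by apply/eqP; rewrite eq_sym subr_eq -ractDl subrK. Qed.

Let lactB r (x y : M) : r **: (x - y) = r **: x - r **: y.
Proof. by apply/eqP; rewrite eq_sym subr_eq -lactDr subrK. Qed.

Fact right_linear_zmod_closed : zmod_closed right_linear.
Proof.
split=> [|f g].
  rewrite unfold_in; apply/asboolP; split=> [x y|x r] /=; first by rewrite subrr.
  exact/esym/(additive_map0 (f := ract^~ r))/(fun y z => ractB y z r).
rewrite !unfold_in => /asboolP[fB fR] /asboolP[gB gR]; apply/asboolP.
split=> [x y|x r]; rewrite -[(f - g) _]/(f _ - g _).
  by rewrite fB gB !opprD addrACA.
by rewrite fR gR ractB.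
Qed.

Fact left_linear_zmod_closed : zmod_closed left_linear.
Proof.
split=> [|f g].
  rewrite unfold_in; apply/asboolP; split=> [x y|r x] /=; first by rewrite subrr.
  exact/esym/(additive_map0 (f := lact r))/(lactB r).
rewrite !unfold_in => /asboolP[fB fR] /asboolP[gB gR]; apply/asboolP.
split=> [x y|r x]; rewrite -[(f - g) _]/(f _ - g _).
  by rewrite fB gB !opprD addrACA.
by rewrite fR gR lactB.
Qed.

HB.instance Definition _ :=
  GRing.isZmodClosed.Build (M -> M) right_linear right_linear_zmod_closed.
HB.instance Definition _ :=
  GRing.isZmodClosed.Build (M -> M) left_linear left_linear_zmod_closed.

HB.instance Definition _ := [SubChoice_isSubZmodule of rend by <:].
HB.instance Definition _ := [SubChoice_isSubZmodule of lend by <:].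

Lemma rend_additive (f : rend) : zmod_morphism f.
Proof. by case: f => f fP; case/asboolP: (fP). Qed.

Lemma rend_linear (f : rend) x r : f (x :** r) = f x :** r.
Proof. by case: f => f fP; case/asboolP: (fP) => _; apply. Qed.

Lemma lend_additive (f : lend) : zmod_morphism f.
Proof. by case: f => f fP; case/asboolP: (fP). Qed.

Lemma lend_linear (f : lend) r x : f (r **: x) = r **: f x.
Proof. by case: f => f fP; case/asboolP: (fP) => _; apply. Qed.

Fact rend_comp_subproof (f g : rend) : (f \o g : M -> M) \in right_linear.
Proof.
rewrite unfold_in; apply/asboolP; split=> [|x r] /=; last by rewrite !rend_linear.
exact: additive_comp (rend_additive f) (rend_additive g).
Qed.

Definition rend_comp (f g : rend) : rend := REnd (rend_comp_subproof f g).

Fact rend_compA : associative rend_comp.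
Proof. by move=> f g h; apply: val_inj. Qed.

Fact rend_compDl : left_distributive rend_comp +%R.
Proof. by move=> f g h; apply: val_inj. Qed.

Fact rend_compDr : right_distributive rend_comp +%R.
Proof.
move=> f g h; apply/val_inj/funext => x.
exact: (additive_mapD (rend_additive f)).
Qed.

HB.instance Definition _ :=
  Zmodule_isRng.Build rend rend_compA rend_compDl rend_compDr.

End ModuleEndomorphisms.

Notation "'End_r' ( M )" := (rend M) : type_scope.
Notation "'End_l' ( M )" := (lend M) : type_scope.

Section Delta.
Variables (R : rngType) (Q : bimodType R).

Fact Delta_subproof (r : R) : (lact r : Q -> Q) \in @right_linear R Q.
Proof.
rewrite unfold_in; apply/asboolP; split=> [x y|x s]; last by rewrite lractA.
by apply/eqP; rewrite eq_sym subr_eq -lactDr subrK.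
Qed.

Definition Delta (r : R) : End_r(Q) := REnd (Delta_subproof r).

Fact Delta_is_additive : zmod_morphism Delta.
Proof.
move=> r s; apply/val_inj/funext => x.
have eqD : Delta (r - s) x + Delta s x = Delta r x by rewrite /= -lactDl subrK.
by rewrite -[RHS]/(Delta r x - Delta s x) -eqD addrK.
Qed.

HB.instance Definition _ := GRing.isZmodMorphism.Build R (rend Q) Delta
  Delta_is_additive.

Lemma DeltaM r s : Delta (r ** s) = Delta r ** Delta s.
Proof. by apply/val_inj/funext => x /=; rewrite lactA. Qed.

Definition ker_Delta : set R := [set r | Delta r = 0].

End Delta.

Arguments ker_Delta {R} Q.

Section System.
Variables (R : rngType) (P Q : bimodType R).
Variable psi : {bimod (P \ox Q) -> regular R}.
Implicit Types (p y : P) (q x : Q).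

Let psiD s t : psi (s + t) = (psi s : R) + (psi t : R).
Proof. exact: raddfD. Qed.

Fact theta_rend_subproof q p :
  (fun x => q :** psi (p \oxe x)) \in @right_linear R Q.
Proof.
rewrite unfold_in; apply/asboolP; split=> [x x'|x r].
  apply/eqP; rewrite eq_sym subr_eq -ractDr -psiD -pure_tensorDr.
  by rewrite subrK.
by rewrite -ract_pure_tensor bimod_homR ractA.
Qed.

(* \theta_{q,p} *)
Definition theta_rend q p : End_r(Q) := REnd (theta_rend_subproof q p).

Fact theta_lend_subproof p q :
  (fun y => psi (y \oxe q) **: p) \in @left_linear R P.
Proof.
rewrite unfold_in; apply/asboolP; split=> [y y'|r y].
  apply/eqP; rewrite eq_sym subr_eq -lactDl -psiD -pure_tensorDl.
  by rewrite subrK.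
by rewrite -lact_pure_tensor bimod_homL lactA.
Qed.

(* \theta_{p,q} *)
Definition theta_lend p q : End_l(P) := LEnd (theta_lend_subproof p q).

(* F_P(Q); the index here is the module acted on. *)
Definition finite_rank_Q : set End_r(Q) :=
  add_span [set f | exists q p, f = theta_rend q p].

(* F_Q(P) *)
Definition finite_rank_P : set End_l(P) :=
  add_span [set f | exists p q, f = theta_lend p q].

Definition condition_FS : Prop :=
  forall (qs : seq Q) (ps : seq P),
  exists (Theta : End_r(Q)) (Omega : End_l(P)),
    [/\ finite_rank_Q Theta, finite_rank_P Omega,
        forall q, q \in qs -> Theta q = q &
        forall p, p \in ps -> Omega p = p].

End System.

Definition two_sided_ideal (R : rngType) (J : set R) : Prop :=
  add_subgroup J /\ forall r x, J x -> J (r ** x) /\ J (x ** r).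

Definition perp (R : rngType) (J : set R) : set R :=
  [set x | forall y, J y -> x ** y = 0 /\ y ** x = 0].

Section CuntzPimsner.
Variables (R : rngType) (P Q : bimodType R).
Variable psi : {bimod (P \ox Q) -> regular R}.
Implicit Types J : set R.

(* Delta^-1(F_P(Q)) *)
Definition finite_rank_preimage : set R :=
  @Delta R Q @^-1` finite_rank_Q psi.

Definition psi_compatible J : Prop := J `<=` finite_rank_preimage.

Definition faithful J : Prop := J `&` ker_Delta Q = [set 0].

Definition faithful_compatible_ideal J : Prop :=
  [/\ two_sided_ideal J, psi_compatible J & faithful J].

Definition uniquely_maximal J : Prop :=
  faithful_compatible_ideal J /\
  forall J', faithful_compatible_ideal J' -> J' `<=` J.

(* The Cuntz-Pimsner ring is the relative Cuntz-Pimsner ring of the uniquely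
   maximal ideal, so it is defined exactly when that ideal exists. *)
Definition cuntz_pimsner_defined : Prop := exists J, uniquely_maximal J.

End CuntzPimsner.

(* Main.v *)
(** The set of finite rank maps absorbs [Delta r] on both sides, because
    [Delta r \o theta_{q,p} = theta_{rq,p}] and, by balancedness,
    [theta_{q,p} \o Delta r = theta_{q,pr}]; so its preimage is an ideal. If [J']
    is a faithful ideal then [J' ** ker Delta] and [ker Delta ** J'] lie in
    [J' `&` ker Delta = 0], that is, [J'] is contained in [(ker Delta)^perp]. *)

Require Import Defs.
From mathcomp Require Import all_boot all_algebra.
From mathcomp Require Import boolp classical_sets.

Local Open Scope ring_scope.
Local Open Scope classical_set_scope.

Import GRing.Theory.

(** [add_subgroup] is phrased through differences, so distributivity is needed in this form. *)
Lemma rngmulBl (R : rngType) (x y z : R) : (x - y) ** z = x ** z - y ** z.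
Proof. by apply/eqP; rewrite eq_sym subr_eq -rngmulDl subrK. Qed.

Lemma rngmulBr (R : rngType) (x y z : R) : x ** (y - z) = x ** y - x ** z.
Proof. by apply/eqP; rewrite eq_sym subr_eq -rngmulDr subrK. Qed.

Lemma rngmul0l (R : rngType) (x : R) : 0 ** x = 0.
Proof. by rewrite -{1}(subrr 0) rngmulBl subrr. Qed.

Lemma rngmul0r (R : rngType) (x : R) : x ** 0 = 0.
Proof. by rewrite -{1}(subrr 0) rngmulBr subrr. Qed.

Lemma two_sided_idealI (R : rngType) (I J : set R) :
  two_sided_ideal I -> two_sided_ideal J -> two_sided_ideal (I `&` J).
Proof.
move=> [[I0 IB] IM] [[J0 JB] JM]; split; first split=> //.
  by move=> x y [xI xJ] [yI yJ]; split; [exact: IB|exact: JB].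
by move=> r x [/(IM r)[rxI xrI] /(JM r)[rxJ xrJ]].
Qed.

(** By associativity $(rx)y = r(xy) = 0$, while $y(rx) = (yr)x$ vanishes because [I] absorbs [r];
    the products with $xr$ are symmetric. *)
Lemma two_sided_ideal_perp (R : rngType) (I : set R) :
  two_sided_ideal I -> two_sided_ideal (perp I).
Proof.
move=> [_ IM]; split; first split=> [y _|x y xI yI z zI].
- by rewrite rngmul0l rngmul0r.
- have [xz zx] := xI z zI; have [yz zy] := yI z zI.
  by rewrite rngmulBl rngmulBr xz zx yz zy subrr.
move=> r x xI; split=> y yI; have [xy yx] := xI y yI.
  by rewrite -rngmulA xy rngmul0r rngmulA (xI _ (IM r y yI).2).2.
by rewrite -rngmulA (xI _ (IM r y yI).1).1 rngmulA yx rngmul0l.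
Qed.

Lemma two_sided_ideal_ker_Delta (R : rngType) (Q : bimodType R) :
  two_sided_ideal (ker_Delta Q).
Proof.
rewrite /ker_Delta; split; first split=> [|x y /= xK yK].
- exact: raddf0.
- by rewrite raddfB /= xK yK subrr.
by move=> r x /= xK; rewrite !DeltaM xK rngmul0l rngmul0r.
Qed.

Lemma finite_rank_Q_absorbs_Delta (R : rngType) (P Q : bimodType R)
    (psi : {bimod (P \ox Q) -> regular R}) (r : R) (f : rend Q) :
  finite_rank_Q psi f ->
  finite_rank_Q psi (Delta Q r ** f) /\ finite_rank_Q psi (f ** Delta Q r).
Proof.
have [F0 FB] := add_span_subgroup [set f | exists q p, f = theta_rend psi q p].
(* The maps whose two products with [Delta Q r] have finite rank form an additive subgroup, so
   minimality of the span leaves only the generators to check. *)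
move: f; apply: (@smallest_sub _ _ _ [set f | finite_rank_Q psi (Delta Q r ** f)
  /\ finite_rank_Q psi (f ** Delta Q r)]).
  split=> [|f g [rf fr] [rg gr]] /=.
    by rewrite rngmul0l rngmul0r.
  by rewrite rngmulBl rngmulBr; split; exact: FB.
move=> _ [q [p ->]]; split; apply: sub_gen_smallest.
  exists (r **: q), p; apply/val_inj/funext => x /=.
  by rewrite lractA.
exists q, (p :** r); apply/val_inj/funext => x /=.
by rewrite pure_tensor_balanced.
Qed.

(** Since [Delta] is multiplicative, absorbing factors from its image is enough for the pullback to
    be an ideal. *)
Lemma two_sided_ideal_finite_rank_preimage (R : rngType) (P Q : bimodType R)
    (psi : {bimod (P \ox Q) -> regular R}) :
  two_sided_ideal (finite_rank_preimage psi).
Proof.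
have [F0 FB] := add_span_subgroup [set f | exists q p, f = theta_rend psi q p].
split; first split=> [|x y xF yF]; rewrite /finite_rank_preimage /preimage /=.
- by rewrite raddf0.
- by rewrite raddfB; exact: FB.
by move=> r x xF; rewrite !DeltaM; exact: finite_rank_Q_absorbs_Delta.
Qed.

(** Applied below with [I] the kernel of [Delta] and [J] a competing faithful ideal, which yields
    maximality. *)
Lemma disjoint_ideal_sub_perp (R : rngType) (I J : set R) :
  two_sided_ideal I -> two_sided_ideal J -> J `&` I = [set 0] -> J `<=` perp I.
Proof.
move=> [_ IM] [_ JM] JI0 x xJ y yI.
have eq0 z : J z -> I z -> z = 0.
  by move=> zJ zI; have : (J `&` I) z by []; rewrite JI0.
have [yx xy] := JM y x xJ; have [xyI yxI] := IM x y yI.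
by split; exact: eq0.
Qed.

Theorem lemma5p2 (R : rngType) (P Q : bimodType R)
    (psi : {bimod (P \ox Q) -> regular R}) :
  condition_FS psi ->
  (finite_rank_preimage psi `&` perp (ker_Delta Q)) `&` ker_Delta Q = [set 0] ->
  uniquely_maximal psi (finite_rank_preimage psi `&` perp (ker_Delta Q)) /\
  cuntz_pimsner_defined psi.
Proof.
move=> _ J_faithful.
have J_max :
    uniquely_maximal psi (finite_rank_preimage psi `&` perp (ker_Delta Q)).
  have K_ideal := two_sided_ideal_ker_Delta R Q.
  split=> [|J' [J'_ideal J'_compatible J'_faithful] x xJ'].
    (* Faithfulness is the assumption [J_faithful], and compatibility is the first component of the
       intersection. *)
    split=> //; last by move=> x [].
    apply: two_sided_idealI; last exact: two_sided_ideal_perp.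
    exact: two_sided_ideal_finite_rank_preimage.
  split; first exact: J'_compatible.
  exact: (disjoint_ideal_sub_perp _ _ _ K_ideal J'_ideal J'_faithful).
by split; last exists (finite_rank_preimage psi `&` perp (ker_Delta Q)).
Qed.
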